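(* Let $\Lambda$ be a finite dimensional algebra over a field, let $f:A\to B$ be an injective homomorphism of right $\Lambda$-modules and let $n$ be a nonnegative integer. If $\operatorname{dell}B\le n$, then $\operatorname{edell}A\le n$.
   Context: Modules are right $\Lambda$-modules; $\mathrm{mod}\,\Lambda$ denotes the finitely generated ones. $\mathbb N$ is the set of nonnegative integers; the infimum of the empty set is $+\infty$. $\Omega M$ is the kernel of a projective cover of $M$, $\Omega^0M=M$, $\Omega^{n+1}M=\Omega(\Omega^nM)$. ''$U$ is a direct summand of $V$ up to projective summands'' means that $U$ is isomorphic to a direct summand of $V\oplus P$ for some projective $P$. $\operatorname{dell}M$ is the infimum of all $n\in\mathbb N$ such that $\Omega^nM$ is a direct summand of $\Omega^{n+1}N$ up to projective summands for some $N\in\mathrm{mod}\,\Lambda$. $\operatorname{edell}M$ is the infimum of all $n\in\mathbb N$ such that for every integer $k'\ge1$ and every right $\Lambda$-module $X$ of injective dimension $\mathrm{id}\,X=n+k'$ one has $\mathrm{Ext}_\Lambda^{n+k'}(M,X)=0$. *)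

(* Defs.v *)
From HB Require Import structures.
From mathcomp Require Import all_boot all_order all_algebra all_field.
From mathcomp Require Import boolp.
Set Implicit Arguments.
Unset Strict Implicit.
Unset Printing Implicit Defensive.
Import GRing.Theory.
Local Open Scope ring_scope.

(* MathComp modules are left modules; a right module over L is a left module
   over the converse ring L^c. *)
Notation rmodType L := (lmodType L^c).

(* Extended natural numbers: [None] stands for +oo. *)
Definition enat := option nat.

Definition enat_le (x y : enat) : bool :=
  match x, y with
  | _, None => true
  | None, Some _ => false
  | Some m, Some n => (m <= n)%N
  end.

Lemma asbool_ex (S : nat -> Prop) : (exists n, S n) -> exists n, `[< S n >].
Proof. by case=> n Sn; exists n; apply/asboolP. Qed.

Definition enat_inf (S : nat -> Prop) : enat :=
  if pselect (exists n, S n) is left exS then Some (ex_minn (asbool_ex exS))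
  else None.

Lemma enat_inf_le (S : nat -> Prop) (n : nat) :
  enat_le (enat_inf S) (Some n) <-> exists2 m, (m <= n)%N & S m.
Proof.
rewrite /enat_inf; case: pselect => [exS|nexS] /=.
  case: ex_minnP => m /asboolP Sm minm; split=> [le_mn|[p le_pn Sp]].
    by exists m.
  by apply: leq_trans le_pn; apply/minm/asboolP.
by split=> // -[m _ Sm]; case: nexS; exists m.
Qed.

Section Modules.
Variable R : nzRingType.
Implicit Types I K M N P U V W X : lmodType R.

Definition surjective_map (A B : Type) (f : A -> B) : Prop :=
  forall b, exists a, f a = b.

(* Exactness of U -> V -> W at V. *)
Definition exact_at U V W (f : {linear U -> V}) (g : {linear V -> W}) : Prop :=
  forall v, g v = 0 <-> exists u, f u = v.

Definition isomorphic U V : Prop := exists f : {linear U -> V}, bijective f.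

Definition zero_module M : Prop := forall x : M, x = 0.

Definition fin_gen M : Prop :=
  exists (n : nat) (g : 'I_n -> M),
    forall x, exists c : 'I_n -> R, x = \sum_i c i *: g i.

Definition projective P : Prop :=
  forall (U V : lmodType R) (p : {linear U -> V}) (g : {linear P -> V}),
    surjective_map p -> exists h : {linear P -> U}, forall x, p (h x) = g x.

Definition injective_module I : Prop :=
  forall (U V : lmodType R) (i : {linear U -> V}) (g : {linear U -> I}),
    injective i -> exists h : {linear V -> I}, forall x, h (i x) = g x.

(* The kernel of p is superfluous: ker p + L = U forces L = U for every
   submodule L of U. *)
Definition superfluous_ker U V (p : {linear U -> V}) : Prop :=
  forall L : {pred U}, GRing.submod_closed L ->
    (forall x, exists2 y, p y = 0 & x - y \in L) -> forall x, x \in L.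

Definition projective_cover P M (p : {linear P -> M}) : Prop :=
  [/\ projective P, surjective_map p & superfluous_ker p].

(* [syzygy M K]: K is isomorphic to Omega M. Projective covers are unique only
   up to isomorphism, so Omega is a relation here. *)
Definition syzygy M K : Prop :=
  exists (P : lmodType R) (p : {linear P -> M}) (i : {linear K -> P}),
    [/\ projective_cover p, injective i & exact_at i p].

Fixpoint nth_syzygy (n : nat) M K : Prop :=
  if n is n'.+1 then
    exists L : lmodType R, nth_syzygy n' M L /\ syzygy L K
  else isomorphic M K.

Definition direct_summand U V : Prop :=
  exists W : lmodType R, isomorphic (U * W)%type V.

Definition summand_up_to_projective U V : Prop :=
  exists P : lmodType R, projective P /\ direct_summand U (V * P)%type.

Definition dell M : enat :=
  enat_inf (fun n =>
    exists N, fin_gen N /\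
    exists K K' : lmodType R,
      [/\ nth_syzygy n M K, nth_syzygy n.+1 N K'
        & summand_up_to_projective K K']).

(* An exact sequence 0 -> X -> I 0 -> I 1 -> ... with I i injective for all i
   and I i = 0 for i > m. *)
Record inj_resolution X (m : nat) := InjResolution {
  ires_obj :> nat -> lmodType R;
  ires_d : forall i, {linear ires_obj i -> ires_obj i.+1};
  ires_aug : {linear X -> ires_obj 0};
  ires_injective : forall i, injective_module (ires_obj i);
  ires_aug_inj : injective ires_aug;
  ires_exact0 : exact_at ires_aug (ires_d 0);
  ires_exactS : forall i, exact_at (ires_d i) (ires_d i.+1);
  ires_length : forall i, (m < i)%N -> zero_module (ires_obj i)
}.

Definition inj_dim X : enat := enat_inf (fun m => inhabited (inj_resolution X m)).

Record proj_resolution M := ProjResolution {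
  pres_obj :> nat -> lmodType R;
  pres_d : forall i, {linear pres_obj i.+1 -> pres_obj i};
  pres_aug : {linear pres_obj 0 -> M};
  pres_projective : forall i, projective (pres_obj i);
  pres_aug_surj : surjective_map pres_aug;
  pres_exact0 : exact_at (pres_d 0) pres_aug;
  pres_exactS : forall i, exact_at (pres_d i.+1) (pres_d i)
}.

End Modules.

(* Hom_R(U, V) is only an abelian group, as R need not be commutative. *)
Section HomGroup.
Variables (R : nzRingType) (U V : lmodType R).

Definition Hom : Type := {linear U -> V}.

HB.instance Definition _ := gen_eqMixin Hom.
HB.instance Definition _ := gen_choiceMixin Hom.

Definition hom_fun (f : Hom) : U -> V := (f : {linear U -> V}).

Lemma homP (f g : Hom) : (forall x, hom_fun f x = hom_fun g x) -> f = g.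
Proof.
rewrite /hom_fun; case: f g => [f cf] [g cg] /= /funext efg.
subst g; congr GRing.Linear.Pack.
case: cf cg => [[a1] [a2]] [[b1] [b2]].
by rewrite (Prop_irrelevance a1 b1) (Prop_irrelevance a2 b2).
Qed.

Definition hom0 : Hom := (\0 : {linear U -> V}).
Definition homN (f : Hom) : Hom := (\- (f : {linear U -> V}) : {linear U -> V}).
Definition homD (f g : Hom) : Hom :=
  ((f : {linear U -> V}) \+ (g : {linear U -> V}) : {linear U -> V}).

Lemma homDA : associative homD.
Proof. by move=> f g h; apply: homP => x; exact: addrA. Qed.
Lemma homDC : commutative homD.
Proof. by move=> f g; apply: homP => x; exact: addrC. Qed.
Lemma hom0D : left_id hom0 homD.
Proof. by move=> f; apply: homP => x; exact: add0r. Qed.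
Lemma homND : left_inverse hom0 homN homD.
Proof. by move=> f; apply: homP => x; exact: addNr. Qed.

HB.instance Definition _ := GRing.isZmodule.Build Hom homDA homDC hom0D homND.

Lemma hom_fun0 x : hom_fun 0 x = 0. Proof. by []. Qed.
Lemma hom_funB f g x : hom_fun (f - g) x = hom_fun f x - hom_fun g x.
Proof. by []. Qed.

End HomGroup.

(* Ext^n_R(M, X) is the n-th cohomology group of the complex Hom_R(P, X), for
   P a projective resolution of M. *)
Section Ext.
Variables (R : nzRingType) (M X : lmodType R) (P : proj_resolution M).

Definition is_cocycle n (f : Hom (P n) X) : Prop :=
  forall x, hom_fun f (pres_d P n x) = 0.

Definition is_coboundary n : Hom (P n) X -> Prop :=
  match n with
  | 0 => fun f => f = 0
  | n'.+1 => fun f => exists g : Hom (P n') X,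
      forall x, hom_fun f x = hom_fun g (pres_d P n' x)
  end.

Definition cocycles n : {pred Hom (P n) X} := fun f => `[< is_cocycle f >].

Lemma cocycles_closed n : zmod_closed (@cocycles n).
Proof.
split; first by apply/asboolP.
move=> f g /asboolP Zf /asboolP Zg; apply/asboolP => x.
by rewrite hom_funB Zf Zg subrr.
Qed.

HB.instance Definition _ n :=
  GRing.isZmodClosed.Build (Hom (P n) X) (@cocycles n) (@cocycles_closed n).

Definition Cocycle n : Type := {f : Hom (P n) X | f \in @cocycles n}.

HB.instance Definition _ n := SubChoice.on (Cocycle n).
HB.instance Definition _ n := [SubChoice_isSubZmodule of Cocycle n by <:].

Definition coboundaries n : {pred Cocycle n} :=
  fun f => `[< is_coboundary (val f) >].

Lemma coboundaries_closed n : zmod_closed (@coboundaries n).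
Proof.
case: n => [|n]; split.
- by apply/asboolP.
- move=> f g /asboolP /= Bf /asboolP /= Bg; apply/asboolP => /=.
  by rewrite Bf Bg subr0.
- by apply/asboolP; exists 0.
move=> f g /asboolP /= [f' Bf] /asboolP /= [g' Bg]; apply/asboolP => /=.
by exists (f' - g') => x; rewrite hom_funB -Bf -Bg.
Qed.

HB.instance Definition _ n :=
  GRing.isZmodClosed.Build (Cocycle n) (@coboundaries n) (@coboundaries_closed n).

Definition Ext n : zmodType := Quotient.quot (@coboundaries n).

Lemma Ext_trivialP n :
  (forall e : Ext n, e = 0) <->
  (forall f : Hom (P n) X, is_cocycle f -> is_coboundary f).
Proof.
split=> [E0 f Zf|BZ e].
  have Zf' : f \in @cocycles n by apply/asboolP.
  pose c : Cocycle n := exist _ f Zf'.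
  have : c - 0 \in @coboundaries n.
    rewrite Quotient.idealrBE; apply/eqP.
    by rewrite [LHS](E0 (\pi_(Quotient.quot (@coboundaries n))%qT c)) [RHS]E0.
  by rewrite subr0 => /asboolP.
rewrite -[e]reprK; have -> : 0 = \pi_(Quotient.quot (@coboundaries n))%qT 0 :> Ext n.
  by rewrite raddf0.
apply/eqP; rewrite -Quotient.idealrBE subr0; apply/asboolP.
by apply: BZ; apply/asboolP; exact: (valP (repr e)).
Qed.

End Ext.

(* Ext^n_R(M, X) = 0. Ext does not depend, up to isomorphism, on the projective
   resolution; none is singled out here. *)
Definition Ext_eq0 (R : nzRingType) (n : nat) (M X : lmodType R) : Prop :=
  forall (P : proj_resolution M) (e : Ext X P n), e = 0.

Definition edell (R : nzRingType) (M : lmodType R) : enat :=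
  enat_inf (fun n =>
    forall (k' : nat) (X : lmodType R), (1 <= k')%N ->
      inj_dim X = Some (n + k')%N -> Ext_eq0 (n + k') M X).

(* Main.v *)
(* Let m <= n be such that Omega^m B is, up to projectives, a summand of
   Omega^(m+1) N, and let I be an injective resolution of X of length
   d = m + k'. Compute Ext as the cohomology of Hom(-, I). As I vanishes above
   d, the top cohomology is right exact: a map A -> I_d extends to B because I_d
   is injective, and the extension is automatically a cocycle. So it suffices
   that H^d(Hom(B, I)) = 0, and dimension shifting identifies this group with
   H^k'(Hom(Omega^m B, I)), a direct summand of
   H^k'(Hom(Omega^(m+1) N, I)) = H^(d+1)(Hom(N, I)) = 0. *)
Require Import Defs.
From HB Require Import structures.
From mathcomp Require Import all_boot all_order all_algebra all_field.
From mathcomp Require Import boolp.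
Set Implicit Arguments.
Unset Strict Implicit.
Unset Printing Implicit Defensive.
Import GRing.Theory.
Local Open Scope ring_scope.

Section LinearMaps.
Variable R : nzRingType.
Implicit Types U V W P I : lmodType R.

Lemma linear_bundle U V (h : U -> V) :
  linear h -> exists g : {linear U -> V}, g =1 h.
Proof.
move=> lin_h.
pose hL := GRing.isLinear.Build R U V _ h lin_h.
pose g : {linear U -> V} := HB.pack h hL.
by exists g.
Qed.

Lemma linear_of_relation U V (r : U -> V -> Prop) :
  (forall x, exists y, r x y) ->
  (forall x y y', r x y -> r x y' -> y = y') ->
  (forall a x y x' y', r x y -> r x' y' -> r (a *: x + x') (a *: y + y')) ->
  exists g : {linear U -> V}, forall x, r x (g x).
Proof.
move=> /choice[h rh] r_fun r_lin.
have [|g gh] := linear_bundle (h := h).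
  by move=> a x y; apply: r_fun (rh _) _; apply: r_lin.
by exists g => x; rewrite gh.
Qed.

Lemma factor_through_surjection U V W (p : {linear U -> V})
    (g : {linear U -> W}) :
  surjective_map p -> (forall x, p x = 0 -> g x = 0) ->
  exists h : {linear V -> W}, forall x, h (p x) = g x.
Proof.
move=> p_surj ker_pg.
have [|||h rh] :=
  @linear_of_relation V W (fun v w => exists2 u, p u = v & g u = w).
- by move=> v; have [u puv] := p_surj v; exists (g u), u.
- move=> v w w' [u pu <-] [u' pu' <-]; apply/eqP.
  by rewrite -subr_eq0 -(linearB g) ker_pg // linearB pu pu' subrr.
- move=> a v w v' w' [u <- <-] [u' <- <-].
  by exists (a *: u + u'); rewrite linearP.
exists h => x; have [u pu <-] := rh (p x); apply/eqP.
by rewrite -subr_eq0 -(linearB g) ker_pg // linearB pu subrr.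
Qed.

Lemma factor_through_injection U V W (i : {linear V -> W})
    (g : {linear U -> W}) :
  injective i -> (forall x, exists v, i v = g x) ->
  exists h : {linear U -> V}, forall x, i (h x) = g x.
Proof.
move=> i_inj im_gi.
apply: (@linear_of_relation U V (fun x v => i v = g x)) => //.
  by move=> x v v' <- /i_inj.
by move=> a x v x' v' iv iv'; rewrite !linearP iv iv'.
Qed.

Section Image.
Variables (U V : lmodType R) (f : {linear U -> V}).

Definition im_pred : {pred V} := fun v => `[< exists u, f u = v >].

Lemma im_pred_closed : GRing.submod_closed im_pred.
Proof.
split; first by apply/asboolP; exists 0; rewrite linear0.
move=> a v v' /asboolP[u <-] /asboolP[u' <-]; apply/asboolP.
by exists (a *: u + u'); rewrite linearP.
Qed.

HB.instance Definition _ :=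
  GRing.isSubmodClosed.Build R V im_pred im_pred_closed.

Definition im_mod : Type := {v : V | v \in im_pred}.

HB.instance Definition _ := SubChoice.on im_mod.
HB.instance Definition _ := [SubChoice_isSubLmodule of im_mod by <:].

Lemma image_factorization :
  exists (K : lmodType R) (q : {linear U -> K}) (i : {linear K -> V}),
    [/\ surjective_map q, injective i & forall x, i (q x) = f x].
Proof.
pose i : {linear im_mod -> V} := val.
have i_inj : injective i by exact: val_inj.
have [x|q qE] := @factor_through_injection U im_mod V i f i_inj.
  have fx : f x \in im_pred by apply/asboolP; exists x.
  by exists (exist _ (f x) fx).
exists im_mod, q, i; split=> // v.
have /asboolP[u fu] := valP v; exists u.
by apply: i_inj; rewrite qE fu.
Qed.

End Image.

Lemma injective_extend U V I (f : {linear U -> V}) (g : {linear U -> I}) :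
  injective_module I -> (forall x, f x = 0 -> g x = 0) ->
  exists h : {linear V -> I}, forall x, h (f x) = g x.
Proof.
move=> injI ker_fg; have [K [q [i [q_surj i_inj qE]]]] := image_factorization f.
have [|g' g'E] := @factor_through_surjection _ _ _ q g q_surj.
  by move=> x qx; apply: ker_fg; rewrite -qE qx linear0.
have [h hE] := injI _ _ i g' i_inj.
by exists h => x; rewrite -qE hE g'E.
Qed.

Lemma projective_lift U V P (f : {linear U -> V}) (g : {linear P -> V}) :
  projective P -> (forall x, exists u, f u = g x) ->
  exists h : {linear P -> U}, forall x, f (h x) = g x.
Proof.
move=> projP im_gf; have [K [q [i [q_surj i_inj qE]]]] := image_factorization f.
have [|g' g'E] := @factor_through_injection _ _ _ i g i_inj.
  by move=> x; have [u fu] := im_gf x; exists (q u); rewrite qE.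
have [h hE] := projP _ _ q g' q_surj.
by exists h => x; rewrite -qE hE g'E.
Qed.

End LinearMaps.

Section Cohomology.
Variables (R : nzRingType) (X : lmodType R) (d : nat) (I : inj_resolution X d).
Implicit Types M N K P U W : lmodType R.

Local Notation dI := (ires_d I).

Lemma ires_dd j x : dI j.+1 (dI j x) = 0.
Proof. by apply/ires_exactS; exists x. Qed.

(* [cohom_eq0 j M]: the cohomology of Hom(M, I) vanishes in degree j + 1. *)
Definition cohom_eq0 j M : Prop :=
  forall a : {linear M -> I j.+1}, (forall x, dI j.+1 (a x) = 0) ->
  exists b : {linear M -> I j}, forall x, dI j (b x) = a x.

Lemma cohom_eq0_above j M : (d <= j)%N -> cohom_eq0 j M.
Proof.
move=> le_dj a _; exists (\0 : {linear M -> I j}) => x /=.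
have I0 := ires_length (i0 := I) (i := j.+1) le_dj.
by rewrite [LHS]I0 [RHS]I0.
Qed.

Lemma cohom_eq0_projective j P : projective P -> cohom_eq0 j P.
Proof.
move=> projP a da; apply: projective_lift => // x.
by apply/ires_exactS/da.
Qed.

Lemma cohom_eq0_retract j U W (i : {linear U -> W}) (r : {linear W -> U}) :
  cancel i r -> cohom_eq0 j W -> cohom_eq0 j U.
Proof.
move=> irK HW a da.
have [x|b db] := HW (a \o r : {linear W -> I j.+1}); first exact: da.
by exists (b \o i : {linear U -> I j}) => x /=; rewrite db /= irK.
Qed.

Lemma cohom_eq0_iso j U W :
  isomorphic U W -> cohom_eq0 j U <-> cohom_eq0 j W.
Proof.
move=> [f [g fK gK]].
have [a x y|g' g'E] := @linear_bundle R W U g.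
  by apply: (can_inj fK); rewrite linearP !gK.
by split; [apply: (@cohom_eq0_retract _ _ _ g' f)
  | apply: (@cohom_eq0_retract _ _ _ f g')] => x; rewrite g'E.
Qed.

Lemma cohom_eq0_prod j U W :
  cohom_eq0 j U -> cohom_eq0 j W -> cohom_eq0 j (U * W)%type.
Proof.
move=> HU HW a da.
have [c x y|iU iUE] := @linear_bundle R U (U * W)%type (fun u => (u, 0)).
  by congr pair; rewrite /= ?scaler0 ?addr0.
have [c x y|iW iWE] := @linear_bundle R W (U * W)%type (fun w => (0, w)).
  by congr pair; rewrite /= ?scaler0 ?addr0.
have [x|bU dbU] := HU (a \o iU : {linear U -> I j.+1}); first exact: da.
have [x|bW dbW] := HW (a \o iW : {linear W -> I j.+1}); first exact: da.
have [c x y|b bE] :=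
    @linear_bundle R (U * W)%type (I j) (fun x => bU x.1 + bW x.2).
  by rewrite /= !linearP scalerDr addrACA.
exists b => -[u w]; rewrite bE linearD dbU dbW /= -linearD iUE iWE.
by congr (a (_, _)); rewrite ?addr0 ?add0r.
Qed.

Lemma cohom_eq0_summand_up_to_projective j U W :
  summand_up_to_projective U W -> cohom_eq0 j W -> cohom_eq0 j U.
Proof.
move=> [P [projP [C UC_WP]]] HW.
have /(cohom_eq0_iso j UC_WP) : cohom_eq0 j (W * P)%type.
  by apply: cohom_eq0_prod => //; apply: cohom_eq0_projective.
have [c x y|iU iUE] := @linear_bundle R U (U * C)%type (fun u => (u, 0)).
  by congr pair; rewrite /= ?scaler0 ?addr0.
have [//|r rE] := @linear_bundle R (U * C)%type U fst.
by apply: (@cohom_eq0_retract _ _ _ iU r) => x; rewrite rE iUE.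
Qed.

Lemma cohom_eq0_top_sub j M N (f : {linear M -> N}) :
  (d <= j.+1)%N -> injective f -> cohom_eq0 j N -> cohom_eq0 j M.
Proof.
move=> le_dj f_inj HN a _.
have [g gE] := ires_injective (i0 := I) (i := j.+1) a f_inj.
have [x|b db] := HN g.
  exact: (ires_length (i0 := I) (i := j.+2)).
by exists (b \o f : {linear M -> I j}) => x /=; rewrite db gE.
Qed.

Section DimensionShift.
Variables (K P M : lmodType R) (i : {linear K -> P}) (p : {linear P -> M}).
Hypotheses (projP : projective P) (p_surj : surjective_map p).
Hypotheses (i_inj : injective i) (ip_exact : exact_at i p).

Let pi0 x : p (i x) = 0. Proof. by apply/ip_exact; exists x. Qed.

Lemma cohom_eq0_shift_down j : cohom_eq0 j.+1 M -> cohom_eq0 j K.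
Proof.
move=> HM a da.
have [h hE] := ires_injective (i0 := I) (i := j.+1) a i_inj.
have [x|a' a'E] := @factor_through_surjection _ _ _ _ p
    (dI j.+1 \o h : {linear P -> I j.+2}) p_surj.
  by move=> /ip_exact[y <-] /=; rewrite hE da.
have [x|b db] := HM a'.
  by have [y <-] := p_surj x; rewrite a'E ires_dd.
have [x|c dc] := cohom_eq0_projective projP
    (a := h \- (b \o p) : {linear P -> I j.+1}).
  by rewrite /= linearB db a'E subrr.
exists (c \o i : {linear K -> I j}) => x /=.
by rewrite dc /= pi0 linear0 subr0 hE.
Qed.

Lemma cohom_eq0_shift_up j : cohom_eq0 j K -> cohom_eq0 j.+1 M.
Proof.
move=> HK a da.
have [x|h dh] := cohom_eq0_projective projP
    (a := a \o p : {linear P -> I j.+2}); first exact: da.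
have [x|b db] := HK (h \o i : {linear K -> I j.+1}).
  by rewrite /= dh /= pi0 linear0.
have [b' b'E] := ires_injective (i0 := I) (i := j) b i_inj.
have [x|c cE] := @factor_through_surjection _ _ _ _ p
    (h \- (dI j \o b') : {linear P -> I j.+1}) p_surj.
  by move=> /ip_exact[y <-] /=; rewrite b'E db subrr.
exists c => x; have [y <-] := p_surj x.
by rewrite cE /= linearB ires_dd subr0 dh.
Qed.

End DimensionShift.

Lemma cohom_eq0_syzygy j M K :
  syzygy M K -> cohom_eq0 j K <-> cohom_eq0 j.+1 M.
Proof.
move=> [P [p [i [[projP p_surj _] i_inj ip_exact]]]]; split.
  exact: (@cohom_eq0_shift_up _ _ _ i p).
exact: (@cohom_eq0_shift_down _ _ _ i p).
Qed.

Lemma cohom_eq0_nth_syzygy n j M K :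
  nth_syzygy n M K -> cohom_eq0 j K <-> cohom_eq0 (n + j) M.
Proof.
elim: n j K => [|n IHn] j K /=; first by move=> /(cohom_eq0_iso j)[].
move=> [L [/IHn ML /cohom_eq0_syzygy LK]].
by rewrite addSnnS -ML.
Qed.

End Cohomology.

Section Resolutions.
Variables (R : nzRingType).

Section Truncation.
Variables (M K : lmodType R) (P : proj_resolution M).
Variables (q : {linear P 1%N -> K}) (i : {linear K -> P 0%N}).
Hypotheses (q_surj : surjective_map q) (i_inj : injective i).
Hypothesis qE : forall x, i (q x) = pres_d P 0 x.

Let truncation_exact0 : exact_at (pres_d P 1) q.
Proof.
move=> x; rewrite -(pres_exactS (p := P) (i := 0) x) -qE; split=> [->|qx].
  by rewrite linear0.
by apply: i_inj; rewrite qx linear0.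
Qed.

Definition truncation : proj_resolution K :=
  @ProjResolution R K (fun j => P j.+1) (fun j => pres_d P j.+1) q
    (fun j => @pres_projective R M P j.+1) q_surj truncation_exact0
    (fun j => @pres_exactS R M P j.+1).

End Truncation.

Variables (X : lmodType R) (d : nat) (I : inj_resolution X d).

Lemma cohom_eq0_coboundary n (M : lmodType R) (P : proj_resolution M)
    (f : Defs.Hom (P n.+1) X) :
  cohom_eq0 I n M -> is_cocycle f -> is_coboundary f.
Proof.
elim: n M P f => [|n IHn] M P f HM Zf; last first.
  have [K [q [i [q_surj i_inj qE]]]] := image_factorization (pres_d P 0).
  apply: (IHn _ (truncation q_surj i_inj qE) f) => //.
  apply: (@cohom_eq0_shift_down _ _ _ _ _ _ _ i (pres_aug P)) => //.
  - exact: pres_projective.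
  - exact: pres_aug_surj.
  move=> x; rewrite (pres_exact0 (p := P) x); split=> [[y <-]|[y <-]].
    by exists (q y); rewrite qE.
  by have [z <-] := q_surj y; exists z; rewrite qE.
have p_surj := @pres_aug_surj R M P.
pose fL : {linear P 1%N -> X} := f.
have [|x|h hE] := @injective_extend _ _ _ _ (pres_d P 0)
    (ires_aug I \o fL : {linear P 1%N -> I 0%N}).
- exact: ires_injective.
- by move=> /pres_exactS[y <-] /=; rewrite [fL _]Zf linear0.
have [x|a aE] := @factor_through_surjection _ _ _ _ (pres_aug P)
    (ires_d I 0 \o h : {linear P 0%N -> I 1%N}) p_surj.
  move=> /pres_exact0[y <-] /=; rewrite hE.
  by apply/ires_exact0; exists (fL y).
have [x|b db] := HM a.
  by have [y <-] := p_surj x; rewrite aE ires_dd.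
have [|x|c cE] := @factor_through_injection _ _ _ _ (ires_aug I)
    (h \- (b \o pres_aug P) : {linear P 0%N -> I 0%N}).
- exact: ires_aug_inj.
- by apply/ires_exact0; rewrite /= linearB db aE subrr.
exists (c : Defs.Hom (P 0%N) X) => x.
apply: (@ires_aug_inj _ _ _ I); rewrite [RHS]cE /= hE.
suff -> : pres_aug P (pres_d P 0 x) = 0 by rewrite linear0 subr0.
by apply/pres_exact0; exists x.
Qed.

End Resolutions.

Theorem lemma2p20 (k : fieldType) (L : falgType k) (A B : rmodType L)
    (f : {linear A -> B}) (n : nat) :
  injective f -> enat_le (dell B) (Some n) -> enat_le (edell A) (Some n).
Proof.
move=> f_inj /enat_inf_le[m le_mn [N [_ [K [K' [BK NK' KK']]]]]].
apply/enat_inf_le; exists m => // -[//|k'] X _ idX P.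
have /enat_inf_le[d le_d [I]] : enat_le (inj_dim X) (Some (m + k'.+1)%N).
  by rewrite idX /=.
move: le_d; rewrite addnS => le_d.
apply/Ext_trivialP => g; apply: (cohom_eq0_coboundary (I := I)).
apply: (cohom_eq0_top_sub (f := f)) => //.
apply/(cohom_eq0_nth_syzygy _ _ BK).
apply: cohom_eq0_summand_up_to_projective KK' _.
apply/(cohom_eq0_nth_syzygy _ _ NK').
by apply: cohom_eq0_above; rewrite addSn.
Qed.
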